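(* Let $A=\Bbbk Q/I$ be a monomial special multiserial UMP algebra, with $R$ a minimal set of relations such that $I=\langle R\rangle$. Then any perfect path in $A$, if it exists, must take one of the following forms: (1) an arrow; or (2) a power of a cycle $u=u^0u^1\cdots u^{l_u}$ (with $u^0,\dots,u^{l_u}\in Q_1$) such that there exists an integer $l\geq 2$ with $u^{(l)}\in R$, and $\beta u^0\notin R$ and $u^{l_u}\alpha\notin R$ for all arrows $\alpha,\beta$ in the quiver $Q$.
   Context: Setting: $\Bbbk$ is an algebraically closed field, $Q$ is a finite connected quiver with arrow set $Q_1$ and source and target maps $s,t$; $I$ is an admissible ideal of $\Bbbk Q$, and $A=\Bbbk Q/I$ (finite-dimensional). Paths are composed from left to right: $\alpha\beta$ is a path when $t(\alpha)=s(\beta)$ (products of non-composable paths are $0$). $A$ is monomial if $I$ is generated by paths; then $R$ is the minimal set of paths generating $I$. A nontrivial path $w$ is written $w=w^0w^1\cdots w^{l_w}$ with $w^i\in Q_1$, so its length is $l_w+1$. A cycle is a nontrivial path $u$ with $s(u)=t(u)$, and $u^{(p)}$ denotes the composition of $u$ with itself $p$ times ($u^{(1)}=u$). A path is nonzero if it is not in $I$, i.e. has no subpath in $R$. UMP algebras: for a path $\mathfrak m$ of $Q$, $\mathfrak m+I$ is a maximal path of $A$ if $\mathfrak m\notin I$ and $\alpha\mathfrak m\in I$ and $\mathfrak m\alpha\in I$ for every arrow $\alpha\in Q_1$. Two paths of $Q$ are disjoint if they have no common nontrivial subpath. Two maximal paths $\mathfrak m+I$, $\mathfrak m'+I$ are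 disjoint if any path $w$ of $Q$ representing $\mathfrak m+I$ and any path $w'$ of $Q$ representing $\mathfrak m'+I$ are disjoint. $A$ is a UMP algebra if any two different maximal paths of $A$ are disjoint. $A$ is special multiserial if for every arrow $\alpha\in Q_1$ there is at most one arrow $\beta\in Q_1$ such that $\alpha\beta\notin I$ and at most one arrow $\gamma\in Q_1$ such that $\gamma\alpha\notin I$. A pair $(p,q)$ of nonzero paths in $A$ is perfect if: (P1) $p,q$ are nontrivial, $t(p)=s(q)$ and $pq=0$ in $A$; (P2) if $q'$ is a nonzero path with $s(q')=t(p)$ and $pq'=0$ in $A$, then $q'=qq''$ for some path $q''$; (P3) if $p'$ is a nonzero path with $t(p')=s(q)$ and $p'q=0$ in $A$, then $p'=p''p$ for some path $p''$. A nonzero path $p$ is a perfect path if there exists a sequence $p=p_1,\dots,p_n,p_{n+1}=p$ of nonzero paths such that $(p_i,p_{i+1})$ is a perfect pair for all $1\le i\le n$. *)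

(* Defs.v *)
From HB Require Import structures.
From mathcomp Require Import all_boot ssralg.
From mathcomp Require Import finmap.
From mathcomp.multinomials Require Import monalg.

Set Implicit Arguments.
Unset Strict Implicit.
Unset Printing Implicit Defensive.

Import GRing.Theory.
Local Open Scope ring_scope.

Record quiver := Quiver {
  Q0 : finType;
  Q1 : finType;
  src : Q1 -> Q0;
  tgt : Q1 -> Q0 }.

Arguments src {q} _.
Arguments tgt {q} _.

Definition quiver_adj (Q : quiver) : rel (Q0 Q) :=
  fun x y => [exists a : Q1 Q, (src a == x) && (tgt a == y)
                            || (src a == y) && (tgt a == x)].

Definition connected_quiver (Q : quiver) : Prop :=
  (0 < #|Q0 Q|)%N /\ forall x y : Q0 Q, connect (@quiver_adj Q) x y.

(* A path is encoded by its source together with its (possibly empty) list of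
   arrows, read from left to right; the empty list gives the trivial path. *)
Fixpoint walk (Q : quiver) (x : Q0 Q) (s : seq (Q1 Q)) : bool :=
  if s is a :: s' then (src a == x) && walk (tgt a) s' else true.

Record qpath (Q : quiver) := QPath {
  qpath_val : Q0 Q * seq (Q1 Q);
  _ : walk qpath_val.1 qpath_val.2 }.

HB.instance Definition _ (Q : quiver) := [isSub for @qpath_val Q].

(* Opaque instances: otherwise unification may try to decide equalities in the
   path algebra by unfolding them. *)
Fact qpath_hasDecEq (Q : quiver) : hasDecEq (qpath Q).
Proof. exact: (Choice.eqtype_hasDecEq_mixin (Choice.class (sub_type (qpath Q)))). Qed.

HB.instance Definition _ (Q : quiver) := qpath_hasDecEq Q.

Fact qpath_hasChoice (Q : quiver) : hasChoice (qpath Q).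
Proof. exact: (Choice.choice_hasChoice_mixin (Choice.class (sub_type (qpath Q)))). Qed.

HB.instance Definition _ (Q : quiver) := qpath_hasChoice Q.

Section Paths.
Variable Q : quiver.
Implicit Types (p q u w : qpath Q) (a : Q1 Q).

Definition psrc p : Q0 Q := (val p).1.
Definition arrows p : seq (Q1 Q) := (val p).2.
Definition ptgt p : Q0 Q := last (psrc p) (map tgt (arrows p)).

Definition nontrivial p : Prop := arrows p <> [::].

Definition qtriv (x : Q0 Q) : qpath Q := @QPath Q (x, [::]) isT.

Lemma walk_arrow a : walk (src a) [:: a].
Proof. by rewrite /= eqxx. Qed.

Definition qarrow a : qpath Q := @QPath Q (src a, [:: a]) (walk_arrow a).

(* Composition is partial: the value is [None] when t(p) <> s(q). *)
Definition qcomp p q : option (qpath Q) :=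
  if ptgt p == psrc q then insub (psrc p, arrows p ++ arrows q) else None.

(* [qpow u n] is u^(n); it is defined for all n when u is a cycle. *)
Fixpoint qpow u (n : nat) : option (qpath Q) :=
  if n is n'.+1 then obind (qcomp u) (qpow u n') else Some (qtriv (psrc u)).

Definition is_cycle u : Prop := nontrivial u /\ psrc u = ptgt u.

Definition subpath u w : Prop :=
  exists a b : qpath Q, obind (qcomp a) (qcomp u b) = Some w.

Definition disjoint_paths p q : Prop :=
  ~ exists u, [/\ nontrivial u, subpath u p & subpath u q].

(* [mem_opt R (qcomp p q)]: the composition pq exists and lies in R. *)
Definition mem_opt (R : qpath Q -> Prop) (o : option (qpath Q)) : Prop :=
  if o is Some r then R r else False.

Lemma walk_cat x (s t : seq (Q1 Q)) :
  walk x (s ++ t) = walk x s && walk (last x (map tgt s)) t.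
Proof. by elim: s x => //= a s IHs x; rewrite IHs andbA. Qed.

Lemma qpathP p q : psrc p = psrc q -> arrows p = arrows q -> p = q.
Proof.
rewrite /psrc /arrows => h1 h2; apply: val_inj.
by case: (val p) (val q) h1 h2 => [x s] [y t] /= -> ->.
Qed.

Lemma qcompP p q r :
  qcomp p q = Some r <->
  [/\ ptgt p = psrc q, psrc r = psrc p & arrows r = arrows p ++ arrows q].
Proof.
rewrite /qcomp; split.
  case: eqP => // pq; case: insubP => //= u _ uE [<-].
  by move: uE; rewrite /psrc /arrows /= => ->.
case=> pq sr ar; rewrite pq eqxx; case: insubP => [u _ uE|] /=.
  by congr Some; apply: val_inj; rewrite /= uE -sr -ar -surjective_pairing.
case/negP; rewrite walk_cat; apply/andP; split; first exact: (valP p).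
by rewrite -/(ptgt p) pq; exact: (valP q).
Qed.

Lemma ptgt_qcomp p q r : qcomp p q = Some r -> ptgt r = ptgt q.
Proof.
by case/qcompP => pq sr ar; rewrite /ptgt sr ar map_cat last_cat -/(ptgt p) pq.
Qed.

Lemma qcompA p q r :
  obind (qcomp p) (qcomp q r) = obind (qcomp^~ r) (qcomp p q).
Proof.
have hN x y : qcomp x y = None -> ptgt x <> psrc y.
  rewrite /qcomp; case: eqP => // xy; case: insubP => //= /negP[].
  rewrite walk_cat; apply/andP; split; first exact: (valP x).
  by rewrite -/(ptgt x) xy; exact: (valP y).
case Eqr: (qcomp q r) => [u|]; case Epq: (qcomp p q) => [v|] //=.
- have [h1 h2 h3] := (qcompP _ _ _).1 Eqr.
  have [g1 g2 g3] := (qcompP _ _ _).1 Epq.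
  case E: (qcomp v r) => [w|]; last first.
    by case: (hN _ _ E); rewrite (ptgt_qcomp Epq).
  have [f1 f2 f3] := (qcompP _ _ _).1 E.
  by apply/qcompP; split; rewrite ?h2 // ?f2 ?f3 // h3 g3 catA.
- have [h1 h2 h3] := (qcompP _ _ _).1 Eqr.
  case E: (qcomp p u) => [w|] //; case: (hN _ _ Epq).
  by have [-> _ _] := (qcompP _ _ _).1 E.
- case E: (qcomp v r) => [w|] //; case: (hN _ _ Eqr).
  by rewrite -(ptgt_qcomp Epq); have [-> _ _] := (qcompP _ _ _).1 E.
Qed.

Lemma qcomp1p x p : qcomp (qtriv x) p = if x == psrc p then Some p else None.
Proof.
case: eqP => [->|ne]; first by apply/qcompP; split.
by rewrite /qcomp; case: eqP.
Qed.

Lemma qcompp1 x p : qcomp p (qtriv x) = if x == ptgt p then Some p else None.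
Proof.
case: eqP => [->|ne]; first by apply/qcompP; split; rewrite //= cats0.
by rewrite /qcomp; case: eqP => // h; case: ne.
Qed.

End Paths.

(* The path algebra kQ: the free k-module on the paths of Q, with the product
   of two paths being their composition, or 0 when they do not compose. *)
Definition pathalg (k : fieldType) (Q : quiver) : Type := {malg k[qpath Q]}.

HB.instance Definition _ (k : fieldType) (Q : quiver) :=
  GRing.Lmodule.copy (pathalg k Q) {malg k[qpath Q]}.

Section PathAlgebra.
Variables (k : fieldType) (Q : quiver).
Local Notation kQ := (pathalg k Q).
Implicit Types (x y z : kQ) (p q r : qpath Q).

Definition pelt p : kQ := (<< p >> : {malg k[qpath Q]}).

Definition oelt (o : option (qpath Q)) : kQ :=
  if o is Some r then pelt r else 0.

Definition pamul x y : kQ :=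
  \sum_(p <- msupp x) \sum_(q <- msupp y)
     (mcoeff p x * mcoeff q y) *: oelt (qcomp p q).

Definition paone : kQ := \sum_(v : Q0 Q) pelt (qtriv v).

Lemma pamulEw (d1 d2 : {fset qpath Q}) x y :
  (msupp x `<=` d1)%fset -> (msupp y `<=` d2)%fset ->
  pamul x y = \sum_(p <- d1) \sum_(q <- d2)
     (mcoeff p x * mcoeff q y) *: oelt (qcomp p q).
Proof.
move=> le1 le2; rewrite /pamul (big_fset_incl _ le1) /=; last first.
  by move=> p _ /mcoeff_outdom ->; rewrite big1 // => q _; rewrite mul0r scale0r.
apply: eq_bigr => p _; rewrite (big_fset_incl _ le2) //.
by move=> q _ /mcoeff_outdom ->; rewrite mulr0 scale0r.
Qed.

Lemma pamulDl : left_distributive pamul +%R.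
Proof.
move=> x y z; pose d := (msupp x `|` msupp y)%fset.
have hx : (msupp x `<=` d)%fset by apply: fsubsetUl.
have hy : (msupp y `<=` d)%fset by apply: fsubsetUr.
have hxy : (msupp (x + y) `<=` d)%fset by apply: msuppD_le.
have hz := fsubset_refl (msupp z).
rewrite (pamulEw hxy hz) (pamulEw hx hz) (pamulEw hy hz) -big_split /=.
apply: eq_bigr => p _; rewrite -big_split /=; apply: eq_bigr => q _.
by rewrite mcoeffD mulrDl scalerDl.
Qed.

Lemma pamulDr : right_distributive pamul +%R.
Proof.
move=> z x y; pose d := (msupp x `|` msupp y)%fset.
have hx : (msupp x `<=` d)%fset by apply: fsubsetUl.
have hy : (msupp y `<=` d)%fset by apply: fsubsetUr.
have hxy : (msupp (x + y) `<=` d)%fset by apply: msuppD_le.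
have hz := fsubset_refl (msupp z).
rewrite (pamulEw hz hxy) (pamulEw hz hx) (pamulEw hz hy) -big_split /=.
apply: eq_bigr => p _; rewrite -big_split /=; apply: eq_bigr => q _.
by rewrite mcoeffD mulrDr scalerDl.
Qed.

Lemma pamulZl c x y : pamul (c *: x) y = c *: pamul x y.
Proof.
have hx := fsubset_refl (msupp x); have hy := fsubset_refl (msupp y).
rewrite (pamulEw (msuppZ_le c x) hy) (pamulEw hx hy) scaler_sumr.
apply: eq_bigr => p _; rewrite scaler_sumr; apply: eq_bigr => q _.
by rewrite mcoeffZ -mulrA scalerA.
Qed.

Lemma pamulZr c x y : pamul x (c *: y) = c *: pamul x y.
Proof.
have hx := fsubset_refl (msupp x); have hy := fsubset_refl (msupp y).
rewrite (pamulEw hx (msuppZ_le c y)) (pamulEw hx hy) scaler_sumr.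
apply: eq_bigr => p _; rewrite scaler_sumr; apply: eq_bigr => q _.
by rewrite mcoeffZ mulrCA scalerA.
Qed.

Lemma pamul0l x : pamul 0 x = 0.
Proof. by rewrite /pamul msupp0 big_seq_fset0. Qed.

Lemma pamul0r x : pamul x 0 = 0.
Proof. by rewrite /pamul big1 // => p _; rewrite msupp0 big_seq_fset0. Qed.

Lemma pamulUU p q : pamul (pelt p) (pelt q) = oelt (qcomp p q).
Proof.
rewrite (pamulEw (@msuppU_le _ _ p 1) (@msuppU_le _ _ q 1)).
by rewrite !big_seq_fset1 !mcoeffUU mulr1 scale1r.
Qed.

Lemma pathalg_ind (P : kQ -> Prop) :
  P 0 -> (forall x y, P x -> P y -> P (x + y)) ->
  (forall c x, P x -> P (c *: x)) -> (forall p, P (pelt p)) -> forall x, P x.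
Proof.
move=> P0 PD PZ Pp x; rewrite [x]monalgE.
elim/big_ind: _ => // p _; suff -> : << mcoeff p x *g p >> = mcoeff p x *: pelt p.
  exact: PZ.
by apply/malgP => q; rewrite mcoeffZ !mcoeffU mulrnAr mulr1.
Qed.

Lemma pamulA : associative pamul.
Proof.
move=> x y z.
elim/pathalg_ind: x => [|x x' IH IH'|c x IH|p].
- by rewrite !pamul0l.
- by rewrite !pamulDl IH IH'.
- by rewrite !pamulZl IH.
elim/pathalg_ind: y => [|x x' IH IH'|c x IH|q].
- by rewrite pamul0l pamul0r pamul0l.
- rewrite (pamulDl x x' z) (pamulDr _ (pamul x z) (pamul x' z)).
  by rewrite (pamulDr _ x x') (pamulDl (pamul _ x) (pamul _ x')) IH IH'.
- rewrite (pamulZl c x z) (pamulZr c _ (pamul x z)) (pamulZr c _ x).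
  by rewrite (pamulZl c (pamul _ x)) IH.
elim/pathalg_ind: z => [|x x' IH IH'|c x IH|r].
- by rewrite !pamul0r.
- rewrite (pamulDr _ x x') (pamulDr _ (pamul _ x) (pamul _ x')).
  by rewrite (pamulDr _ x x') IH IH'.
- rewrite (pamulZr c _ x) (pamulZr c _ (pamul _ x)) (pamulZr c _ x).
  by rewrite IH.
rewrite !pamulUU; have := qcompA p q r.
case: (qcomp q r) => [u|]; case: (qcomp p q) => [v|] //= h.
- by rewrite !pamulUU h.
- by rewrite pamulUU h pamul0l.
- by rewrite pamulUU -h pamul0r.
- by rewrite pamul0l pamul0r.
Qed.

Lemma pamul1l : left_id paone pamul.
Proof.
move=> x; elim/pathalg_ind: x => [|x x' IH IH'|c x IH|p].
- by rewrite pamul0r.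
- by rewrite pamulDr IH IH'.
- by rewrite pamulZr IH.
have -> : pamul paone (pelt p) = \sum_(v : Q0 Q) pamul (pelt (qtriv v)) (pelt p).
  exact: (big_morph (pamul^~ (pelt p)) (fun x y => pamulDl x y _) (pamul0l _)).
rewrite (bigD1 (psrc p)) //= pamulUU qcomp1p eqxx /= big1 ?addr0 // => v hv.
by rewrite pamulUU qcomp1p (negPf hv).
Qed.

Lemma pamul1r : right_id paone pamul.
Proof.
move=> x; elim/pathalg_ind: x => [|x x' IH IH'|c x IH|p].
- by rewrite pamul0l.
- by rewrite pamulDl IH IH'.
- by rewrite pamulZl IH.
have -> : pamul (pelt p) paone = \sum_(v : Q0 Q) pamul (pelt p) (pelt (qtriv v)).
  exact: (big_morph (pamul (pelt p)) (fun x y => pamulDr _ x y) (pamul0r _)).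
rewrite (bigD1 (ptgt p)) //= pamulUU qcompp1 eqxx /= big1 ?addr0 // => v hv.
by rewrite pamulUU qcompp1 (negPf hv).
Qed.

End PathAlgebra.

HB.instance Definition _ (k : fieldType) (Q : quiver) :=
  GRing.Zmodule_isPzRing.Build (pathalg k Q)
    (@pamulA k Q) (@pamul1l k Q) (@pamul1r k Q) (@pamulDl k Q) (@pamulDr k Q).

Section Ideals.
Variables (k : fieldType) (Q : quiver).
Local Notation kQ := (pathalg k Q).
Implicit Types (I J : kQ -> Prop).

(* Stability under scalars follows, since c *: x = (c *: 1) * x. *)
Record two_sided_ideal I : Prop := TwoSidedIdeal {
  ideal0 : I 0;
  idealD : forall x y, I x -> I y -> I (x + y);
  idealMl : forall a x, I x -> I (a * x);
  idealMr : forall x a, I x -> I (x * a) }.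

Definition ideal_gen (S : kQ -> Prop) : kQ -> Prop :=
  fun x => forall J, two_sided_ideal J -> (forall s, S s -> J s) -> J x.

Definition ideal_mul I J : kQ -> Prop :=
  ideal_gen (fun z => exists x y, [/\ I x, J y & z = x * y]).

Fixpoint ideal_pow I (n : nat) : kQ -> Prop :=
  if n is n'.+1 then ideal_mul (ideal_pow I n') I else fun=> True.

Definition arrow_ideal : kQ -> Prop :=
  ideal_gen (fun x => exists a : Q1 Q, x = pelt k (qarrow a)).

Definition admissible I : Prop :=
  two_sided_ideal I /\
  exists m : nat, [/\ (2 <= m)%N,
    forall x, ideal_pow arrow_ideal m x -> I x &
    forall x, I x -> ideal_pow arrow_ideal 2 x].

Definition generated_by_paths I (R : qpath Q -> Prop) : Prop :=
  forall x, I x <-> ideal_gen (fun y => exists2 r, R r & y = pelt k r) x.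

(* R is a minimal set of paths generating I; a given I admits such an R exactly
   when it is generated by paths, i.e. when kQ/I is a monomial algebra. *)
Definition minimal_path_generators I (R : qpath Q -> Prop) : Prop :=
  generated_by_paths I R /\
  forall R' : qpath Q -> Prop, (forall r, R' r -> R r) ->
    generated_by_paths I R' -> forall r, R r -> R' r.

End Ideals.

(* Properties of the algebra A = kQ/I, expressed through representatives: an
   element x of kQ vanishes in A iff [I x]. *)
Section QuotientAlgebra.
Variables (k : fieldType) (Q : quiver) (I : pathalg k Q -> Prop).
Implicit Types (p q m w : qpath Q) (a b c : Q1 Q).

Definition nonzero_path p : Prop := ~ I (pelt k p).

(* w + I = m + I in A. *)
Definition represents w m : Prop := I (pelt k w - pelt k m).

Definition maximal_path m : Prop :=
  ~ I (pelt k m) /\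
  forall a, I (pelt k (qarrow a) * pelt k m) /\ I (pelt k m * pelt k (qarrow a)).

Definition disjoint_classes m m' : Prop :=
  forall w w', represents w m -> represents w' m' -> disjoint_paths w w'.

Definition UMP : Prop :=
  forall m m', maximal_path m -> maximal_path m' ->
    ~ represents m m' -> disjoint_classes m m'.

Definition special_multiserial : Prop :=
  forall a,
    (forall b b', ~ I (pelt k (qarrow a) * pelt k (qarrow b)) ->
                  ~ I (pelt k (qarrow a) * pelt k (qarrow b')) -> b = b') /\
    (forall c c', ~ I (pelt k (qarrow c) * pelt k (qarrow a)) ->
                  ~ I (pelt k (qarrow c') * pelt k (qarrow a)) -> c = c').

Definition perfect_pair p q : Prop :=
  [/\ nonzero_path p /\ nonzero_path q,
      [/\ nontrivial p, nontrivial q, ptgt p = psrc q & I (pelt k p * pelt k q)],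
      forall q', nonzero_path q' -> psrc q' = ptgt p -> I (pelt k p * pelt k q') ->
        exists q'', qcomp q q'' = Some q' &
      forall p', nonzero_path p' -> ptgt p' = psrc q -> I (pelt k p' * pelt k q) ->
        exists p'', qcomp p'' p = Some p'].

(* p = p_1, ..., p_n, p_{n+1} = p is [ps 1, ..., ps n.+1]; without n >= 1 every
   nonzero path would qualify. *)
Definition perfect_path p : Prop :=
  nonzero_path p /\
  exists (n : nat) (ps : nat -> qpath Q),
    [/\ (1 <= n)%N, ps 1%N = p, ps n.+1 = p &
        forall i, (1 <= i <= n)%N -> perfect_pair (ps i) (ps i.+1)].

End QuotientAlgebra.

(* Main.v *)
Require Import Defs.
From mathcomp Require Import all_boot ssralg.
From mathcomp Require Import finmap.
From mathcomp.multinomials Require Import monalg.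
From Stdlib Require Import Classical.

(* If (p, q) is a perfect pair, then every proper nontrivial subpath of pq is
   nonzero, so pq is a relation. In a special multiserial algebra, a relation of
   length at least 3 loses its first arrow to become a path that begins a maximal
   path; hence, under UMP, two such relations whose tails share an arrow coincide.
   For consecutive perfect pairs (o, p), (p, q), (q, r) with p not an arrow this
   gives op = pq, and then o = q: if q is not an arrow because also pq = qr, and
   if q is an arrow because op = pq forces all arrows to be equal. So p and q
   commute as words, hence are powers of a common cycle u, and pq = u^(l) is the
   required relation. *)

Set Implicit Arguments.
Unset Strict Implicit.
Unset Printing Implicit Defensive.

Import GRing.Theory.

(** * Combinatorics on words: commutation and common powers *)

Section CommutingWords.
Variable T : eqType.
Implicit Types u v x y : seq T.

(** Word counterpart of [qpow]; it is total, since words carry no endpoints to match. *)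
Definition wpow u n := flatten (nseq n u).

Lemma wpowS u n : wpow u n.+1 = u ++ wpow u n.
Proof. by []. Qed.

Lemma wpowD u m n : wpow u (m + n) = wpow u m ++ wpow u n.
Proof. by rewrite /wpow nseqD flatten_cat. Qed.

(** Euclid's algorithm: the shorter word is a prefix of the longer, [y = x ++ z], and cancelling it
    leaves [x] and [z] commuting with smaller total length. *)
Lemma catC_wpow x y :
  x ++ y = y ++ x -> exists u m n, x = wpow u m /\ y = wpow u n.
Proof.
have [k] := ubnP (size x + size y); elim: k x y => // k IHk x y.
wlog le_xy : x y / size x <= size y => [IH|].
  case: (leqP (size x) (size y)) => [|/ltnW] le_xy lt_k xy; first exact: IH.
  by rewrite addnC in lt_k; have [u [m [n []]]] := IH _ _ le_xy lt_k (esym xy);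
     exists u, n, m.
move=> lt_k xy; case: x => [|a x] in le_xy lt_k xy *.
  by exists y, 0, 1; rewrite wpowS cats0.
have := congr1 (take (size (a :: x))) xy.
rewrite take_size_cat // takel_cat // => yE.
have := cat_take_drop (size (a :: x)) y; rewrite -yE => yE'.
set z := drop _ _ in yE'; have zE: (a :: x) ++ z = z ++ a :: x.
  move: xy; rewrite -yE' -catA => /eqP; rewrite eqseq_cat // eqxx /=.
  by move/eqP.
have [|u [m [n [xE zE']]]] := IHk _ _ _ zE.
  rewrite -ltnS; apply: leq_trans lt_k; rewrite -yE' size_cat ltnS.
  by rewrite ltn_add2l /= addSn ltnS leq_addl.
by exists u, m, (m + n); split=> //; rewrite wpowD -xE -zE' yE'.
Qed.

End CommutingWords.

(** * Perfect pairs and relations, in terms of an abstract class of nonzero words *)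

(* [N s] reads "the word s is a nontrivial path that is nonzero in A". *)
Section Words.
Variables (T : eqType) (e : rel T) (N : seq T -> Prop).
Implicit Types (a b c : T) (p q s t w : seq T).

Hypothesis N_neq0 : forall s, N s -> s <> [::].
Hypothesis N_infix : forall s1 s s2, N (s1 ++ s ++ s2) -> s <> [::] -> N s.
Hypothesis N_bounded : exists B, forall s, N s -> size s < B.
Hypothesis N_pred_uniq : forall a b b', N [:: b; a] -> N [:: b'; a] -> b = b'.

Definition maximal_word m :=
  N m /\ forall a, ~ N (a :: m) /\ ~ N (rcons m a).

Hypothesis UMP_words : forall m m' a,
  maximal_word m -> maximal_word m' -> a \in m -> a \in m' -> m = m'.

(** Conditions (P1) to (P3) on arrow words; [sorted e] on a concatenation expresses that the
    endpoints match. *)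
Definition perfect_words p q :=
  [/\ N p /\ N q, sorted e (p ++ q) /\ ~ N (p ++ q),
      forall q', N q' -> sorted e (p ++ q') -> ~ N (p ++ q') ->
        exists t, q' = q ++ t &
      forall p', N p' -> sorted e (p' ++ q) -> ~ N (p' ++ q) ->
        exists t, p' = t ++ p].

(** Stands for membership in [R] without mentioning generators; [minimal_zero_relation] makes the
    link. *)
Definition minimal_zero w :=
  ~ N w /\ forall s1 s s2, w = s1 ++ s ++ s2 -> s <> [::] ->
             size s < size w -> N s.

(** A proper subword misses the first or the last letter of [p ++ q]. If dropping the first letter
    left a zero word, (P3) would make the shortened [p] end with [p] itself, absurd by length; if
    [p] is one letter, the nonzero [q] is left. Symmetrically, (P2) handles the last letter. *)
Lemma perfect_words_minimal_zero p q :
  perfect_words p q -> minimal_zero (p ++ q).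
Proof.
case=> [[Np Nq] [spq npq] P2 P3]; split=> // s1 s s2 wE s0 ltsw.
case: s1 => [|a s1] in wE *; last first.
  case: p => [|a' p] in Np npq spq P2 P3 wE ltsw *; first by case: (N_neq0 Np).
  case: wE => _ wE.
  have Npq: N (p ++ q).
    case: p => [//|b p] in Np npq spq P2 P3 wE ltsw *.
    apply: NNPP => n; have [||t] := P3 (b :: p) _ _ n.
    - by apply: (@N_infix [:: a'] _ [::]); rewrite ?cats0.
    - by move: spq => /= /andP[].
    - move/(congr1 size)/eqP; rewrite size_cat /= => /eqP h.
      by have := leq_addl (size t) (size p).+2; rewrite -h ltnn.
  by rewrite wE in Npq; apply: N_infix Npq s0.
case/lastP: s2 => [|s2 a] in wE *.
  by move: ltsw; rewrite wE /= cats0 ltnn.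
case/lastP: q => [|q a'] in Nq npq spq P2 P3 wE ltsw *.
  by case: (N_neq0 Nq).
move: wE; rewrite -!rcons_cat => /rcons_inj[wE _].
have Npq: N (p ++ q).
  case/lastP: q => [|q b] in Nq npq spq P2 P3 wE ltsw *.
    by rewrite cats0.
  apply: NNPP => n; have [||t] := P2 (rcons q b) _ _ n.
  - by apply: (@N_infix [::] _ [:: a']); [rewrite cat0s cats1 | case: (q)].
  - by move: spq; rewrite -rcons_cat -cats1 => /cat_sorted2[].
  - move/(congr1 size)/eqP; rewrite size_cat !size_rcons /= => /eqP h.
    by have := leq_addr (size t) (size q).+2; rewrite -h ltnn.
by rewrite wE in Npq; apply: (@N_infix [::]  _ s2) Npq s0.
Qed.

(** Nonzero words have bounded length, so adding letters on the right must stop; the induction is on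
    the gap to the bound. *)
Lemma right_maximal_extension s :
  N s -> exists t, N (s ++ t) /\ forall a, ~ N (rcons (s ++ t) a).
Proof.
have [B bndB] := N_bounded.
have [k] := ubnP (B - size s); elim: k s => // k IHk s lek Ns.
case: (classic (exists a, N (rcons s a))) => [[a Nsa]|mx]; last first.
  by exists [::]; rewrite cats0; split=> // a Nsa; apply: mx; exists a.
have [|t [Nt mt]] := IHk _ _ Nsa.
  rewrite size_rcons -ltnS; apply: leq_trans lek; rewrite ltnS.
  by rewrite ltn_sub2l // bndB.
by exists (a :: t); rewrite -cat_rcons.
Qed.

(* Only the first arrow of the relation can precede its tail, so extending the
   tail to the right as far as possible already gives a maximal path. *)
Lemma maximal_word_of_tail a s :
  minimal_zero (a :: s) -> 1 < size s -> exists t, maximal_word (s ++ t).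
Proof.
case=> nas mas gt1.
have Ns: N s.
  by apply: (mas [:: a] s [::]); rewrite ?cats0 // => s0; rewrite s0 in gt1.
have [t [Nt mt]] := right_maximal_extension Ns; exists t; split=> // c.
split=> // Nc; case: s => [|b s] in nas mas gt1 Ns Nt mt Nc * => //.
have Nab: N [:: a; b] by apply: (mas [::] _ s).
have Ncb: N [:: c; b] by apply: (@N_infix [::] _ (s ++ t)).
rewrite (N_pred_uniq Ncb Nab) in Nc; apply: nas.
by apply: (@N_infix [::] _ t).
Qed.

(** A nonempty [t] would make the zero word [w] a proper subword of a minimal zero word. *)
Lemma minimal_zero_prefix w t :
  minimal_zero w -> minimal_zero (w ++ t) -> w <> [::] -> t = [::].
Proof.
move=> [nw _] [_ mw] w0; case: t => // a t in mw *.
by case: nw; apply: (mw [::] w (a :: t)) => //; rewrite size_cat /= addnS ltnS leq_addr.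
Qed.

(** The tails extend to maximal words sharing [b], which UMP identifies. So both tails begin with
    the same letter, whose unique predecessor gives [a = a'], and one relation is then a prefix of
    the other. *)
Lemma minimal_zero_uniq a s a' s' b :
  minimal_zero (a :: s) -> minimal_zero (a' :: s') ->
  1 < size s -> 1 < size s' -> b \in s -> b \in s' -> a :: s = a' :: s'.
Proof.
move=> mz mz' gt1 gt1' bs bs'.
have [t mt] := maximal_word_of_tail mz gt1.
have [t' mt'] := maximal_word_of_tail mz' gt1'.
have := UMP_words (a := b) mt mt'; rewrite !mem_cat bs bs' => /(_ isT isT).
case: s s' => [|c s] [|c' s'] // in mz mz' gt1 gt1' {bs bs' mt mt'} * => - /= [cc ss].
(* Both relations have at least three letters, so their two-letter prefixes are proper subwords,
   hence nonzero. *)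
have aa: a = a'.
  apply: (@N_pred_uniq c).
    by apply: (proj2 mz [::] _ s).
  by rewrite cc; apply: (proj2 mz' [::] _ s').
rewrite -{}aa -{}cc in mz' *.
wlog le_ss : s s' t t' mz mz' ss {gt1 gt1'} / size s <= size s' => [IH|].
  by case: (leqP (size s) (size s')) => [|/ltnW] /IH h;
     [apply: h ss | symmetry; apply: h (esym ss)].
have := congr1 (take (size s)) ss; rewrite take_size_cat // takel_cat // => sE.
have := cat_take_drop (size s) s'; rewrite -sE => s'E.
have := @minimal_zero_prefix [:: a, c & s] (drop (size s) s') mz.
by rewrite /= s'E => /(_ mz') d0; rewrite -s'E d0 // cats0.
Qed.

Lemma minimal_zero_overlap o p q :
  perfect_words o p -> perfect_words p q -> 1 < size p -> o ++ p = p ++ q.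
Proof.
move=> pop ppq gt1; have mo := perfect_words_minimal_zero pop.
have mp := perfect_words_minimal_zero ppq.
case: pop => [[No _] _ _ _]; case: ppq => [[_ Nq] _ _ _].
case: o => [|a o] in No mo *; first by case: (N_neq0 No).
case: q => [|d q] in Nq mp *; first by case: (N_neq0 Nq).
case: p => [|b [|c p]] // in gt1 mo mp *.
(* The second letter of [p] lies beyond the first letter of both [o ++ p] and [p ++ q]. *)
apply: (minimal_zero_uniq (b := c) mo mp).
- by rewrite size_cat /= !addnS.
- by rewrite /= size_cat /= addnS.
- by rewrite mem_cat !inE eqxx !orbT.
- by rewrite inE eqxx.
Qed.

Lemma perfect_words_powers o p q r :
  perfect_words o p -> perfect_words p q -> perfect_words q r -> 1 < size p ->
  exists u n m, [/\ u <> [::], 0 < n, 0 < m, p = wpow u n & q = wpow u m].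
Proof.
move=> pop ppq pqr gt1; have op := minimal_zero_overlap pop ppq gt1.
have size_oq : size o = size q.
  by move/(congr1 size): op; rewrite !size_cat addnC => /addnI.
have [Np Nq] : N p /\ N q by case: ppq.
have oq : o = q.
  case: (ltnP 1 (size q)) => [gt1q|le1q].
    have := minimal_zero_overlap ppq pqr gt1q; rewrite -op => /eqP.
    by rewrite eqseq_cat // => /andP[/eqP].
  case: q => [|d [|]] // in Nq op size_oq le1q {ppq pqr} *.
    by case: (N_neq0 Nq).
  case: o => [|a [|]] // in op size_oq {pop} *; congr [:: _].
  (* From [a :: p = p ++ [:: d]], comparing letters one by one shows that each equals [a], and
     finally so does [d]. *)
  elim: p op {gt1 Np} => /= [|b p IHp]; first by case.
  by case=> <-; apply: IHp.
rewrite oq in op; have [u [m [n [qE pE]]]] := catC_wpow op.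
have u0 : u <> [::].
  move=> u0; case: (N_neq0 Np); by rewrite pE u0 /wpow; elim: (n).
have n0 : 0 < n by case: n pE gt1 {qE} => // ->.
have m0 : 0 < m by case: m qE (N_neq0 Nq) => // ->.
by exists u, n, m.
Qed.

End Words.

(** * Ideals of the path algebra defined by a condition on supports *)

Section SupportIdeals.
Local Open Scope ring_scope.
Variables (k : fieldType) (Q : quiver).
Local Notation kQ := (pathalg k Q).
Implicit Types (x y : kQ) (p q r : qpath Q) (S : qpath Q -> Prop).

(** [ideal_gen] quantifies over all ideals; instantiating it at ideals of this form bounds the
    supports of elements of a generated ideal. *)
Definition spanned_by S x : Prop := forall p, mcoeff p x != 0 -> S p.

Lemma spanned0 S : spanned_by S 0.
Proof. by move=> p; rewrite mcoeff0 eqxx. Qed.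

Lemma spannedD S x y : spanned_by S x -> spanned_by S y -> spanned_by S (x + y).
Proof.
move=> Sx Sy p; rewrite mcoeffD; have [->|/Sx //] := eqVneq (mcoeff p x) 0.
by rewrite add0r => /Sy.
Qed.

Lemma spannedZ S c x : spanned_by S x -> spanned_by S (c *: x).
Proof.
move=> Sx p; rewrite mcoeffZ => cx; apply: Sx; apply: contraNneq cx => ->.
by rewrite mulr0.
Qed.

Lemma mcoeff_pelt p q : mcoeff p (pelt k q) = (q == p)%:R.
Proof. by rewrite mcoeffU. Qed.

Lemma spanned_pelt S p : S p -> spanned_by S (pelt k p).
Proof.
by move=> Sp q; rewrite mcoeff_pelt; case: (p =P q) => [<-|_] //; rewrite eqxx.
Qed.

Lemma pelt_spanned S p : spanned_by S (pelt k p) -> S p.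
Proof. by apply; rewrite mcoeff_pelt eqxx oner_neq0. Qed.

Lemma spannedM S S1 S2 x y :
  (forall p q r, S1 p -> S2 q -> qcomp p q = Some r -> S r) ->
  spanned_by S1 x -> spanned_by S2 y -> spanned_by S (x * y).
Proof.
move=> SM S1x S2y; change (spanned_by S (pamul x y)); rewrite /pamul.
rewrite big_seq; elim/big_ind: _ => [||p px].
- exact: spanned0.
- exact: spannedD.
rewrite big_seq; elim/big_ind: _ => [||q qy].
- exact: spanned0.
- exact: spannedD.
apply: spannedZ; case E: (qcomp p q) => [r|]; last exact: spanned0.
apply: spanned_pelt; apply: SM E; [apply: S1x | apply: S2y].
  by rewrite mcoeff_neq0.
by rewrite mcoeff_neq0.
Qed.

Lemma spanned_ideal S :
  (forall p q r, S q -> qcomp p q = Some r -> S r) ->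
  (forall p q r, S p -> qcomp p q = Some r -> S r) ->
  two_sided_ideal (spanned_by S).
Proof.
move=> Sl Sr; split; first exact: spanned0.
- exact: spannedD.
- move=> a x Sx; apply: (spannedM (S1 := fun=> True)) Sx => // p q r _.
  exact: Sl.
- move=> x a Sx; apply: (spannedM (S2 := fun=> True)) Sx _ => // p q r Sp _.
  exact: Sr.
Qed.

Lemma mem_ideal_gen (S : kQ -> Prop) x : S x -> ideal_gen S x.
Proof. by move=> Sx J _; apply. Qed.

Lemma pelt_mul p q : pelt k p * pelt k q = oelt k (qcomp p q).
Proof. exact: pamulUU. Qed.

End SupportIdeals.

(** * Translation between paths and their arrow words *)

Section PathsAndWords.
Variable Q : quiver.
Implicit Types (p q r u w : qpath Q) (a b : Q1 Q) (s t : seq (Q1 Q)).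

Definition follows : rel (Q1 Q) := fun a b => tgt a == src b.

Lemma walk_path a s : walk (tgt a) s = path follows a s.
Proof. by elim: s a => //= b s IHs a; rewrite IHs eq_sym. Qed.

Lemma walk_src x a s : walk x (a :: s) -> x = src a.
Proof. by case/andP => /eqP. Qed.

Lemma arrows_sorted p : sorted follows (arrows p).
Proof.
by case: p => -[x [|a s]] //= wp; move: (wp) => /= /andP[_]; rewrite walk_path.
Qed.

Lemma sorted_arrows s : sorted follows s -> s <> [::] -> exists p, arrows p = s.
Proof.
case: s => //= a s ps _.
have ws : walk (src a) (a :: s) by rewrite /= eqxx walk_path.
by exists (@QPath Q (src a, a :: s) ws).
Qed.

Lemma psrc_arrows p a s : arrows p = a :: s -> psrc p = src a.
Proof.
case: p => -[x t] wp; rewrite /arrows /psrc /= => tE.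
by apply: (walk_src (s := s)); rewrite -tE.
Qed.

Lemma ptgt_arrows p a s : arrows p = rcons s a -> ptgt p = tgt a.
Proof. by rewrite /ptgt => ->; rewrite map_rcons last_rcons. Qed.

(** The first arrow determines the source; only trivial paths carry a vertex invisible in the
    word. *)
Lemma arrows_inj p q : arrows p = arrows q -> arrows p <> [::] -> p = q.
Proof.
move=> pq p0; apply: qpathP => //; case E: (arrows p) p0 => [//|a s] _.
by rewrite (psrc_arrows E) (@psrc_arrows q a s) // -pq.
Qed.

Lemma sorted_ptgt_psrc p q :
  arrows p <> [::] -> arrows q <> [::] ->
  sorted follows (arrows p ++ arrows q) -> ptgt p = psrc q.
Proof.
case/lastP Ep: (arrows p) => [//|s a] _; case Eq: (arrows q) => [//|b t] _.
rewrite (ptgt_arrows Ep) (psrc_arrows Eq) cat_rcons => /cat_sorted2[_] /=.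
by case/andP => /eqP.
Qed.

Lemma qcomp_ex p q : ptgt p = psrc q -> exists r, qcomp p q = Some r.
Proof.
move=> pq; rewrite /qcomp pq eqxx; case: insubP => [r _ _|]; first by exists r.
by rewrite walk_cat (valP p) -/(ptgt p) pq (valP q).
Qed.

Lemma subpath_infix s1 s s2 u w :
  arrows w = s1 ++ s ++ s2 -> arrows u = s -> s <> [::] -> subpath u w.
Proof.
move=> wE uE s0.
have sw := arrows_sorted w; rewrite wE in sw.
have [ss1 /cat_sorted2[_ ss2]] := cat_sorted2 sw.
(* An empty flank becomes the trivial path at the matching endpoint of [u]. *)
have {ss1} [a aE atgt] : exists2 a, arrows a = s1 & ptgt a = psrc u.
  case/lastP: s1 => [|s1 c] in wE sw ss1 *; first by exists (qtriv (psrc u)).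
  have [|a aE] := sorted_arrows ss1; first by case: (s1).
  exists a => //; apply: sorted_ptgt_psrc; rewrite ?aE ?uE //; first by case: (s1).
  by move: sw; rewrite catA => /cat_sorted2[].
have {ss2} [b bE btgt] : exists2 b, arrows b = s2 & ptgt u = psrc b.
  case: s2 => [|c s2] in wE sw ss2 *; first by exists (qtriv (ptgt u)).
  have [|b bE] // := sorted_arrows ss2.
  exists b => //; apply: sorted_ptgt_psrc; rewrite ?bE ?uE //.
  by move: sw => /cat_sorted2[].
have [ub ubE] := qcomp_ex btgt; have [_ ubs uba] := (qcompP _ _ _).1 ubE.
exists a, b; rewrite ubE /=; have [w' w'E] : exists w', qcomp a ub = Some w'.
  by apply: qcomp_ex; rewrite atgt ubs.
rewrite w'E; congr Some; have [_ _ w'a] := (qcompP _ _ _).1 w'E.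
have ww : arrows w' = arrows w by rewrite w'a uba aE bE uE wE.
by apply: arrows_inj => //; rewrite w'a uba uE; case: (arrows a) (s) s0 => [|? ?] [].
Qed.

Lemma qpow_cycle u n : is_cycle u ->
  exists r, [/\ qpow u n = Some r, arrows r = wpow (arrows u) n & psrc r = psrc u].
Proof.
case=> _ uC; elim: n => [|n [r [rE ra rs]]] /=; first by exists (qtriv (psrc u)).
have [|r' r'E] := @qcomp_ex u r; first by rewrite -uC rs.
have [_ r's r'a] := (qcompP _ _ _).1 r'E.
by exists r'; rewrite rE /= r'E r'a ra.
Qed.

End PathsAndWords.

(** * Nonzero paths, perfect pairs and maximal paths read on arrow words *)

Section NonzeroWords.
Local Open Scope ring_scope.
Variables (k : fieldType) (Q : quiver) (I : pathalg k Q -> Prop).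
Implicit Types (p q r u w : qpath Q) (a b : Q1 Q) (s t : seq (Q1 Q)).

Hypothesis Iideal : two_sided_ideal I.

Definition nonzero_word s :=
  s <> [::] /\ exists2 p, arrows p = s & nonzero_path I p.

Lemma nonzero_wordP p :
  arrows p <> [::] -> nonzero_word (arrows p) <-> nonzero_path I p.
Proof.
move=> p0; split=> [[_ [q qp nq]]|np]; last by split=> //; exists p.
by have <- : q = p by apply: arrows_inj; rewrite ?qp.
Qed.

Lemma zero_wordP p : arrows p <> [::] -> ~ nonzero_word (arrows p) -> I (pelt k p).
Proof. by move=> p0 n; apply: NNPP => np; apply/n/nonzero_wordP. Qed.

Lemma subpath_zero u w : subpath u w -> I (pelt k u) -> I (pelt k w).
Proof.
case=> a [b]; case ubE: (qcomp u b) => [ub|] //= wE Iu; case: Iideal => _ _ Il Ir.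
have -> : pelt k w = pelt k a * (pelt k u * pelt k b).
  by rewrite pelt_mul ubE /= pelt_mul wE.
by apply: Il; apply: Ir.
Qed.

Lemma nonzero_word_sorted s : nonzero_word s -> sorted (@follows Q) s.
Proof. by case=> _ [p <- _]; apply: arrows_sorted. Qed.

Lemma nonzero_word_infix s1 s s2 :
  nonzero_word (s1 ++ s ++ s2) -> s <> [::] -> nonzero_word s.
Proof.
case=> _ [w wE nw] s0; split=> //.
have sw := arrows_sorted w; rewrite wE in sw.
have [_ /cat_sorted2[ss _]] := cat_sorted2 sw.
have [u uE] := sorted_arrows ss s0; exists u => // Iu; apply: nw.
exact: subpath_zero (subpath_infix wE uE s0) Iu.
Qed.

Lemma mul_nonzero_word p q :
  arrows p <> [::] -> arrows q <> [::] ->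
  nonzero_word (arrows p ++ arrows q) -> ~ I (pelt k p * pelt k q).
Proof.
move=> p0 q0 npq; have pq := sorted_ptgt_psrc p0 q0 (nonzero_word_sorted npq).
have [r rE] := qcomp_ex pq; have [_ _ ra] := (qcompP _ _ _).1 rE.
rewrite pelt_mul rE /=; apply/nonzero_wordP; rewrite ra //.
by case: (arrows p) p0.
Qed.

Lemma mul_zero_word p q :
  arrows p <> [::] -> ~ nonzero_word (arrows p ++ arrows q) ->
  I (pelt k p * pelt k q).
Proof.
(* Without composability the product is 0, which lies in the ideal. *)
move=> p0 npq; rewrite pelt_mul; case rE: (qcomp p q) => [r|]; last first.
  by case: Iideal.
have [_ _ ra] := (qcompP _ _ _).1 rE; apply: zero_wordP; rewrite ra //.
by case: (arrows p) p0.
Qed.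

Lemma perfect_pair_words p q :
  perfect_pair I p q -> perfect_words (@follows Q) nonzero_word (arrows p) (arrows q).
Proof.
case=> [[np nq] [p0 q0 pq Ipq] P2 P3].
have [r rE] := qcomp_ex pq; have [_ _ ra] := (qcompP _ _ _).1 rE.
split.
- by split; apply/nonzero_wordP.
- split; first by rewrite -ra; apply: arrows_sorted.
  by move=> /(mul_nonzero_word p0 q0).
- move=> s [s0 [q' q's nq']]; rewrite -q's in s0 * => spq npq.
  have [|q'' q''E] := P2 q' nq' _ (mul_zero_word p0 npq).
    by rewrite (sorted_ptgt_psrc p0 s0 spq).
  by exists (arrows q''); case/qcompP: q''E.
- move=> s [s0 [p' p's np']]; rewrite -p's in s0 * => spq npq.
  have [|p'' p''E] := P3 p' np' _ (mul_zero_word s0 npq).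
    by rewrite (sorted_ptgt_psrc s0 q0 spq).
  by exists (arrows p''); case/qcompP: p''E.
Qed.

Lemma maximal_word_path p :
  maximal_word nonzero_word (arrows p) -> maximal_path I p.
Proof.
case=> np mp; have p0 : arrows p <> [::] by case: np.
split=> [|a]; first exact/nonzero_wordP.
by have [n1 n2] := mp a; split; apply: mul_zero_word; rewrite ?cats1.
Qed.

Lemma special_multiserial_pred a b b' : special_multiserial I ->
  nonzero_word [:: b; a] -> nonzero_word [:: b'; a] -> b = b'.
Proof.
by case/(_ a) => _ uq nb nb'; apply: uq; apply: mul_nonzero_word.
Qed.

End NonzeroWords.

(** * Consequences of admissibility, of generation by paths and of UMP *)

Section AdmissibleMonomial.
Local Open Scope ring_scope.
Variables (k : fieldType) (Q : quiver) (I : pathalg k Q -> Prop).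
Implicit Types (p q r u w : qpath Q) (a b : Q1 Q) (s t : seq (Q1 Q)).

Hypothesis Iadm : admissible I.

Lemma arrow_ideal_long (x : pathalg k Q) :
  @arrow_ideal k Q x -> spanned_by (fun p => 1 <= size (arrows p))%N x.
Proof.
apply; last by move=> _ [a ->]; apply: spanned_pelt.
by apply: spanned_ideal => p q r pq /qcompP[_ _ ->]; rewrite size_cat;
  apply: leq_trans pq _; rewrite (leq_addl, leq_addr).
Qed.

(** [I] lies in the square of the arrow ideal, whose elements are supported on paths of length at
    least two. *)
Lemma admissible_size p : I (pelt k p) -> (1 < size (arrows p))%N.
Proof.
case: Iadm => _ [m [_ _ I2]] /I2 Ip.
apply: (@pelt_spanned k _ (fun p => 1 < size (arrows p))%N); move: Ip.
have long2 : two_sided_ideal (spanned_by (k := k) (fun p => 1 < size (arrows p))%N).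
  by apply: spanned_ideal => p' q r pq /qcompP[_ _ ->]; rewrite size_cat;
    apply: leq_trans pq _; rewrite (leq_addl, leq_addr).
apply=> // _ [x [y [Ix /arrow_ideal_long Sy ->]]].
(* The first [ideal_pow] is the product of the whole algebra with the arrow ideal, so only the right
   factor gives length. *)
have Sx : spanned_by (fun p => 1 <= size (arrows p))%N x.
  apply: Ix; last first.
    move=> _ [x' [y' [_ /arrow_ideal_long Sy' ->]]].
    apply: (spannedM (S1 := fun=> True)) Sy' => // p' q r _ q1 /qcompP[_ _ ->].
    by rewrite size_cat (leq_trans q1) // leq_addl.
  by apply: spanned_ideal => p' q r pq /qcompP[_ _ ->]; rewrite size_cat;
    apply: leq_trans pq _; rewrite (leq_addl, leq_addr).
apply: spannedM Sx Sy => p' q r p1 q1 /qcompP[_ _ ->].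
by rewrite size_cat (leq_add p1 q1).
Qed.

(** [ideal_pow] multiplies on the right, so the induction peels off the last arrow. *)
Lemma ideal_pow_long n p :
  (n <= size (arrows p))%N -> ideal_pow (@arrow_ideal k Q) n (pelt k p).
Proof.
elim: n p => // n IHn p.
case/lastP E: (arrows p) => [//|s a]; rewrite size_rcons ltnS => len.
have sp := arrows_sorted p; rewrite E in sp.
have [q qE qt] : exists2 q, arrows q = s & ptgt q = src a.
  case: s => [|b s] in E sp len *; first by exists (qtriv (src a)).
  have [||q qE] := @sorted_arrows Q (b :: s) => //.
    by move: sp; rewrite -cats1 => /cat_sorted2[].
  exists q => //; apply: (@sorted_ptgt_psrc _ q (qarrow a)); rewrite ?qE //.
  by rewrite /= cats1.
have [r rE] := @qcomp_ex Q q (qarrow a) qt.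
have [_ _ ra] := (qcompP _ _ _).1 rE.
apply: mem_ideal_gen; exists (pelt k q), (pelt k (qarrow a)); split.
- by apply: IHn; rewrite qE.
- by apply: mem_ideal_gen; exists a.
- rewrite pelt_mul rE /=; congr pelt; apply: arrows_inj.
    by rewrite ra qE E /= cats1.
  by rewrite E; case: (s).
Qed.

Lemma nonzero_word_bounded :
  exists B, forall s, nonzero_word I s -> (size s < B)%N.
Proof.
case: Iadm => _ [m [_ Im _]]; exists m => _ [_ [p <- np]].
by rewrite ltnNge; apply/negP => /ideal_pow_long/Im.
Qed.

Variable R : qpath Q -> Prop.
Hypothesis Igen : generated_by_paths I R.

Lemma mem_relation r : R r -> I (pelt k r).
Proof. by move=> Rr; apply/Igen; apply: mem_ideal_gen; exists r. Qed.

(** Elements supported on paths with a subpath in [R] form an ideal containing [R]. *)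
Lemma monomial_support (x : pathalg k Q) :
  I x -> spanned_by (fun p => exists2 r, R r & subpath r p) x.
Proof.
move/Igen; apply; last first.
  move=> _ [r Rr ->]; apply: spanned_pelt; exists r => //.
  exists (qtriv (psrc r)), (qtriv (ptgt r)).
  by rewrite qcompp1 eqxx /= qcomp1p eqxx.
apply: spanned_ideal => p q r [u Ru [a [b]]]; case E: (qcomp u b) => [v|] //= vE rE.
  exists u => //; case paE: (qcomp p a) => [a'|]; last first.
    by have := qcompA p a v; rewrite vE paE /= rE.
  by exists a', b; rewrite E /=; have := qcompA p a v; rewrite vE paE /= rE.
exists u => //; have := qcompA a v q; rewrite vE /= rE.
case vqE: (qcomp v q) => [vq|] //= aE.
have := qcompA u b q; rewrite E /= vqE; case bqE: (qcomp b q) => [b'|] //= ub.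
by exists a, b'; rewrite ub.
Qed.

(** If [p] and [q] differed, [p] would occur in the difference with coefficient 1, so it would
    contain a relation and vanish. *)
Lemma represents_eq p q :
  nonzero_path I p -> represents I p q -> p = q.
Proof.
move=> np Ipq; apply: NNPP => /eqP neq_pq; apply: np.
have [|r Rr rp] := monomial_support Ipq (p := p).
  by rewrite mcoeffB !mcoeff_pelt eqxx [q == p]eq_sym (negPf neq_pq) subr0 oner_neq0.
by apply: subpath_zero rp (mem_relation Rr); case: Iadm.
Qed.

(** The common arrow is a common nontrivial subpath, so UMP puts both paths in one class, and
    [represents_eq] makes them equal. *)
Lemma UMP_nonzero_words m m' b : UMP I ->
  maximal_word (nonzero_word I) m -> maximal_word (nonzero_word I) m' ->
  b \in m -> b \in m' -> m = m'.
Proof.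
move=> ump mm mm' bm bm'.
have [[_ [p pE np]] _] := mm; have [[_ [p' p'E np']] _] := mm'.
rewrite -{}pE -{}p'E in mm mm' bm bm' *.
have [Iid _] := Iadm; congr arrows; apply: represents_eq => //.
apply: NNPP => nr; have repr q : represents I q q.
  by rewrite /represents subrr; case: Iid.
case: (ump p p' (maximal_word_path Iid mm) (maximal_word_path Iid mm') nr
         p p' (repr p) (repr p')).
exists (qarrow b); split=> //.
  by case/splitPr E: _ / bm => [s1 s2]; apply: (@subpath_infix _ s1 [:: b] s2).
by case/splitPr E: _ / bm' => [s1 s2]; apply: (@subpath_infix _ s1 [:: b] s2).
Qed.

(** The zero path [r] contains some [w] in [R]; a shorter [w] would be nonzero by minimality, so
    [w = r]. *)
Lemma minimal_zero_relation r :
  minimal_zero (nonzero_word I) (arrows r) -> arrows r <> [::] -> R r.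
Proof.
case=> nr mr r0; have [w Rw [a [b]]] := pelt_spanned (monomial_support (zero_wordP r0 nr)).
case E: (qcomp w b) => [v|] //= vE.
have Iw := mem_relation Rw; have w0 : arrows w <> [::].
  by move=> w0; have := admissible_size Iw; rewrite w0.
have [_ _ va] := (qcompP _ _ _).1 E; have [_ _ ra] := (qcompP _ _ _).1 vE.
rewrite va in ra; case: (leqP (size (arrows r)) (size (arrows w))) => [le|lt].
  have <- // : w = r; apply: arrows_inj => //.
  move: le; rewrite ra !size_cat addnCA -{2}[size (arrows w)]addn0 leq_add2l leqn0.
  by rewrite addn_eq0 !size_eq0 => /andP[/eqP-> /eqP->]; rewrite cats0.
by have /(nonzero_wordP I w0) := mr _ _ _ ra w0 lt.
Qed.

End AdmissibleMonomial.

(** * The two forms of a perfect path *)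

Theorem theorem4p1 (k : closedFieldType) (Q : quiver)
    (I : pathalg k Q -> Prop) (R : qpath Q -> Prop)
    (Qconn : connected_quiver Q)
    (Iadm : admissible I)
    (Imono : minimal_path_generators I R)
    (Amulti : special_multiserial I)
    (AUMP : UMP I)
    (p : qpath Q) (perf_p : perfect_path I p) :
  (exists a : Q1 Q, p = qarrow a) \/
  (exists (u : qpath Q) (u0 : Q1 Q) (s : seq (Q1 Q)),
     [/\ is_cycle u /\ arrows u = u0 :: s,
         exists2 n : nat, (1 <= n)%N & qpow u n = Some p,
         exists2 l : nat, (2 <= l)%N & mem_opt R (qpow u l) &
         forall alpha beta : Q1 Q,
           ~ mem_opt R (qcomp (qarrow beta) (qarrow u0)) /\
           ~ mem_opt R (qcomp (qarrow (last u0 s)) (qarrow alpha))]).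
Proof.
have [Iid _] := Iadm; have [Igen _] := Imono.
case: perf_p => np [n [ps [n_gt0 ps1 psn perf]]].
have [o [q [r [pop ppq pqr]]]] : exists o q r,
    [/\ perfect_pair I o p, perfect_pair I p q & perfect_pair I q r].
  (* The sequence closes up, so [ps n] precedes [p]. For [n = 1] it stops at [ps 2 = p], which then
     serves as both [q] and [r]. *)
  exists (ps n), (ps 2), (ps (if n == 1 then 2 else 3)); split.
  - by rewrite -{1}psn; apply: perf; rewrite n_gt0 leqnn.
  - by rewrite -{1}ps1; apply: perf.
  - case: eqP => [n1|/eqP n1]; last by apply: perf; rewrite /= ltn_neqAle eq_sym n1.
    by move: (perf 1); rewrite n1 in psn *; rewrite psn -ps1; apply.
have p0 : arrows p <> [::] by case: ppq => _ [].
have [gt1|le1] := ltnP 1 (size (arrows p)); last first.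
  left; case E: (arrows p) p0 le1 => [|a [|]] // _ _.
  by exists a; apply: arrows_inj; rewrite E.
right; move: pop ppq pqr => /(perfect_pair_words Iid) pop.
move=> /(perfect_pair_words Iid) ppq /(perfect_pair_words Iid) pqr.
have Nneq0 s : nonzero_word I s -> s <> [::] by case.
have Ninf := nonzero_word_infix Iid.
have := perfect_words_powers Nneq0 Ninf (nonzero_word_bounded Iadm)
  (fun a b b' => @special_multiserial_pred _ _ _ a b b' Amulti)
  (fun m m' b => @UMP_nonzero_words _ _ _ Iadm _ Igen m m' b AUMP)
  pop ppq pqr gt1.
have [npq mpq] := perfect_words_minimal_zero Nneq0 Ninf ppq.
case=> v [i [j [v0 i_gt0 j_gt0 pE qE]]].
have pqE : arrows p ++ arrows q = wpow v (i + j) by rewrite wpowD -pE -qE.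
have [_ [spq _] P2 P3] := ppq.
have [u0 [s vE]] : exists u0 s, v = u0 :: s by case: (v) v0 => // u0 s; exists u0, s.
have sv : sorted (@follows Q) v.
  case: i i_gt0 pE {pqE} => // i _ pE; have := arrows_sorted p.
  by rewrite pE wpowS => /cat_sorted2[].
have [u uE] := sorted_arrows sv v0.
(* Both exponents are positive, so [v ++ v] begins the path word of [pq]; this closes [u] into a
   cycle. *)
have svv : sorted (@follows Q) (v ++ v).
  case: i j i_gt0 j_gt0 pqE {pE qE} => [//|i] [//|j] _ _ pqE.
  by move: spq; rewrite pqE addSn addnS !wpowS catA => /cat_sorted2[].
have uC : is_cycle u.
  split; first by rewrite /nontrivial uE.
  by symmetry; apply: sorted_ptgt_psrc; rewrite uE.
exists u, u0, s; split; first by rewrite uE.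
- have [p' [pow_i p'E _]] := qpow_cycle i uC; exists i; rewrite ?pow_i //.
  rewrite uE -pE in p'E.
  by congr Some; apply: arrows_inj; rewrite p'E.
(* Here [l = i + j]: the power is [pq], a minimal zero word. *)
- have [w [wE wa _]] := qpow_cycle (i + j) uC.
  exists (i + j); rewrite ?wE /=; first by rewrite -addn1 leq_add.
  rewrite uE -pqE in wa.
  apply: (minimal_zero_relation Iadm Igen); rewrite wa //.
  by case: (arrows p) p0.
have zeroR x y : mem_opt R (qcomp (qarrow x) (qarrow y)) ->
    sorted (@follows Q) [:: x; y] /\ ~ nonzero_word I [:: x; y].
  case E: (qcomp _ _) => [w|] Rw; last by case: Rw.
  have [_ _ wa] := (qcompP _ _ _).1 E.
  have <- : arrows w = [:: x; y] by rewrite wa.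
  split; first exact: arrows_sorted.
  have w0 : arrows w <> [::] by rewrite wa.
  by case/(nonzero_wordP I w0); apply: (mem_relation Igen).
have arrowN a : nonzero_word I [:: a].
  by split=> //; exists (qarrow a) => // /(admissible_size Iadm).
have [p1 p1E] : exists p1, arrows p = rcons p1 (last u0 s).
  case: i i_gt0 pE {pqE} => // i _ ->; rewrite -addn1 wpowD.
  exists (wpow v i ++ belast u0 s).
  by rewrite rcons_cat -lastI /wpow /= cats0 vE.
have [q1 q1E] : exists q1, arrows q = u0 :: q1.
  by case: j j_gt0 qE {pqE} => // j _ ->; rewrite wpowS vE; eexists.
move=> alpha beta; split=> /zeroR[sxy zxy].
  (* If [beta] kills [u0] it kills [q], and (P3) makes the single arrow [beta] end with [p], which
     is longer. *)
  have [||t] := P3 [:: beta] (arrowN beta).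
  - rewrite q1E; move: sxy (arrows_sorted q); rewrite q1E /= andbT => -> //.
  - by rewrite q1E => nz; apply: zxy; apply: (Ninf [::] _ q1).
  - move/(congr1 size)/eqP; rewrite size_cat /= => /eqP h.
    by have := leq_trans gt1 (leq_addl (size t) _); rewrite -h.
have zpa : ~ nonzero_word I (arrows p ++ [:: alpha]).
  rewrite p1E cat_rcons => nz; apply: zxy.
  by apply: (Ninf p1 _ [::]); rewrite ?cats0.
(* Here (P2) only forces [q] to be the arrow [alpha], which is [u0]. The zero word of the last arrow
   of [p] and [alpha] is then a proper subword of [pq], against minimality. *)
have [|t] := P2 [:: alpha] (arrowN alpha) _ zpa.
  move: (arrows_sorted p); rewrite p1E cat_rcons.
  case: (p1) sxy => [|c p2] /= /andP[la _]; rewrite ?la // => h.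
  by rewrite -cat_rcons cat_path h /= last_rcons la.
rewrite q1E in mpq *; rewrite cat_cons => -[alphaE]; case: q1 q1E mpq => // _ mpq _.
apply: zxy; rewrite alphaE; apply: (mpq p1 _ [::]) => //.
  by rewrite p1E cat_rcons cats0.
by rewrite size_cat /= addn1 ltnS.
Qed.
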